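(* Let $F$ be an isoparametric polynomial of even degree $g\in\{2,4,6\}$ on $\mathbb{R}^n$, and let $G_F^{\pm}(x)=|x|^g\pm F(x)$. Then $|x|^{g-2}G_F^{+}(x)$ and $|x|^{g-2}G_F^{-}(x)$ are each a sum of squares of real forms of degree $g-1$.
   Context: An isoparametric (Cartan–Münzner) polynomial of degree $g$ on $\mathbb{R}^n$ is a real homogeneous polynomial $F$ of degree $g$ satisfying $$|\nabla F|^2=g^2|x|^{2g-2},\qquad \Delta F=\tfrac{g^2}{2}(m_--m_+)|x|^{g-2}\qquad\text{on }\mathbb{R}^n,$$ where the level hypersurfaces $F^{-1}(t)\cap\mathbb{S}^{n-1}$, $t\in(-1,1)$, are isoparametric hypersurfaces of the unit sphere with $g$ distinct principal curvatures and the positive integers $m_\pm$ are the multiplicities of the maximal and minimal principal curvatures with respect to the normal direction $\nabla f/|\nabla f|$, $f=F|_{\mathbb{S}^{n-1}}$. A form is a homogeneous polynomial. *)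

(* Defs.v *)
From HB Require Import structures.
From mathcomp Require Import all_boot all_order all_algebra.
From mathcomp Require Import all_classical all_reals all_analysis.
(* mpoly's notations clash with those of MathComp-Analysis. *)
From mathcomp Require Import -(notations) mpoly.

Set Implicit Arguments.
Unset Strict Implicit.
Unset Printing Implicit Defensive.

Import Order.TTheory GRing.Theory Num.Theory numFieldNormedType.Exports.

Local Open Scope classical_set_scope.
Local Open Scope ring_scope.

Section Euclidean.
Variables (R : realType) (n : nat).

Definition dotp (u v : 'rV[R]_n) : R := \sum_(i < n) u 0 i * v 0 i.

(* The library norm `|x| on 'rV[R]_n is the sup norm. *)
Definition enorm (x : 'rV[R]_n) : R := Num.sqrt (dotp x x).

Definition sphere : set 'rV[R]_n := [set x | enorm x = 1].

End Euclidean.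

Section Polynomials.
Variables (R : realType) (n : nat).
Implicit Types (F : mpoly n R) (x : 'rV[R]_n).

Definition evalp F x : R := meval (fun i => x 0 i) F.

(* d.-homog contains 0 for every d. *)
Definition is_form (d : nat) F : Prop := F \is ishomog1 d mdeg.

Definition grad F x : 'rV[R]_n := \row_(i < n) evalp (mderiv i F) x.

Definition laplacian F x : R := \sum_(i < n) evalp (mderiv i (mderiv i F)) x.

Definition sos_of_forms (d : nat) (h : 'rV[R]_n -> R) : Prop :=
  exists s : seq (mpoly n R),
    (forall p, p \in s -> is_form d p) /\
    (forall x, h x = \sum_(p <- s) evalp p x ^+ 2).

Definition G_plus (g : nat) F x : R := enorm x ^+ g + evalp F x.
Definition G_minus (g : nat) F x : R := enorm x ^+ g - evalp F x.

End Polynomials.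

Section LevelHypersurfaces.
Variables (R : realType) (n : nat).
Implicit Types (F : mpoly n R) (x : 'rV[R]_n).

Definition level_hypersurface F (t : R) : set 'rV[R]_n :=
  [set x | sphere x /\ evalp F x = t].

(* At a point of the unit sphere this is the gradient of f = F|_S, i.e. the
   tangential part of the Euclidean gradient of F. *)
Definition sph_grad F x : 'rV[R]_n := grad F x - dotp (grad F x) x *: x.

(* The unit normal nabla f / |nabla f| of the level hypersurfaces in the sphere,
   extended to R^n by the same formula; the extension is irrelevant below,
   since it is only differentiated in directions tangent to a level. *)
Definition unit_normal F x : 'rV[R]_n :=
  (enorm (sph_grad F x))^-1 *: sph_grad F x.

(* Row space = { v | <v, x> = 0 and <v, nabla f (x)> = 0 }, the tangent space
   at x of the level hypersurface through x. *)
Definition tangent_space F x : 'M[R]_n :=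
  kermx (row_mx x^T (sph_grad F x)^T).

(* Multiplicity of k as a principal curvature at x: the dimension of the space
   of tangent vectors v with A v = k v, where A v = - D_v nu is the shape
   operator with respect to the unit normal nu.  No projection is needed:
   D_v nu is tangent to the sphere, because <D_v nu, x> = - <nu, v> = 0, and it
   is orthogonal to nu, because |nu| = 1.  Matrices act on row vectors. *)
Definition curvature_mult F x (k : R) : nat :=
  \rank (tangent_space F x :&: eigenspace (- jacobian (unit_normal F) x) k)%MS.

(* F^{-1}(t) in the sphere is a (nonempty) hypersurface with g distinct constant
   principal curvatures, the elements of ks in decreasing order, where
   the largest has multiplicity mp and the smallest mm. *)
Definition isoparametric_level F (t : R) (g mp mm : nat) : Prop :=
  level_hypersurface F t !=set0 /\
  exists (ks : seq R) (mult : R -> nat),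
    [/\ size ks = g,
        sorted >%R ks,
        forall k, (0 < mult k)%N = (k \in ks),
        forall x, level_hypersurface F t x ->
          forall k, curvature_mult F x k = mult k
      & mult (head 0 ks) = mp /\ mult (last 0 ks) = mm].

Definition isoparametric_polynomial (g : nat) F : Prop :=
  exists mp mm : nat,
    [/\ (0 < mp)%N /\ (0 < mm)%N,
        is_form g F,
        forall x, enorm (grad F x) ^+ 2 = g%:R ^+ 2 * enorm x ^+ (2 * g - 2),
        forall x, laplacian F x =
          g%:R ^+ 2 / 2%:R * (mm%:R - mp%:R) * enorm x ^+ (g - 2)
      & forall t : R, -1 < t < 1 -> isoparametric_level F t g mp mm].

End LevelHypersurfaces.

(* Main.v *)
(* By Euler's identity [<x, grad F> = g F], so the condition
   [|grad F|^2 = g^2 |x|^(2g-2)] gives, for [e = 1] and [e = -1],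
     [|g |x|^(g-2) x + e grad F|^2 = 2 g^2 |x|^(g-2) (|x|^g + e F)].
   As [g] is even, the coordinates of the vector on the left are forms of
   degree [g - 1]. *)
Require Import Defs.
From mathcomp Require Import all_boot all_order all_algebra.
From mathcomp Require Import all_classical all_reals all_analysis.
From mathcomp Require Import -(notations) mpoly.
From mathcomp Require Import ring.

Import GRing.Theory Num.Theory.

Local Open Scope ring_scope.

Section Forms.
#[local] Set Implicit Arguments.
Variables (R : realType) (n : nat).
Implicit Types (F p q : mpoly n R) (x : 'rV[R]_n).

Definition varp (i : 'I_n) : mpoly n R := mpolyX R (mnm1 i).

Lemma varp_mderivX (i : 'I_n) (m : multinom n) :
  varp i * mderiv i (mpolyX R m) = mpolyX R m *+ m i.
Proof.
(* If [m i = 0], the subtraction of exponents truncates, but the scalar [m i] kills the term. *)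
rewrite mderivX -scalerAr -mpolyXD -[RHS]scaler_nat; have [->|mi] := posnP (m i).
  by rewrite !scale0r.
by rewrite addmC submK ?lep1mP -?lt0n.
Qed.

(** Euler's identity, checked on monomials: [varp i * mderiv i] multiplies a monomial by its
    exponent [m i], and these exponents add up to [d]. *)
Lemma euler_form d F :
  is_form d F -> \sum_(i < n) varp i * mderiv i F = F *+ d.
Proof.
move=> /dhomogP hF; rewrite {2}(mpolyE F) -sumrMnl.
transitivity (\sum_(i < n) \sum_(m <- msupp F)
    (mcoeff m F *: mpolyX R m) *+ m i).
  apply: eq_bigr => i _; rewrite {1}(mpolyE F) raddf_sum /= mulr_sumr.
  by apply: eq_bigr => m _; rewrite mderivZ -scalerAr varp_mderivX scalerMnr.
rewrite exchange_big; apply: eq_big_seq => m /hF <- /=.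
by rewrite sumrMnr -mdegE.
Qed.

(** For [d = 0] the truncated degree [d - 1] is harmless: every exponent is then 0, so the
    derivative vanishes. *)
Lemma is_form_mderiv d F i : is_form d F -> is_form (d - 1) (mderiv i F).
Proof.
move=> /dhomogP hF; rewrite /is_form (mpolyE F) raddf_sum /=.
rewrite big_seq; apply: rpred_sum => m /hF dm.
rewrite mderivZ mderivX scalerA; have [->|mi] := posnP (m i).
  by rewrite mulr0 scale0r rpred0.
rewrite rpredZ // dhomogX -dm -[in (mdeg m - 1)%N](submK (m := mnm1 i) (m' := m)).
  by rewrite mdegD mdeg1 addnK.
by rewrite lep1mP -lt0n.
Qed.

(** [enorm] is a square root, so its even powers enter the forms through this polynomial. *)
Definition sqnormp : mpoly n R := \sum_(i < n) varp i ^+ 2.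

Lemma is_form_varp i : is_form 1 (varp i).
Proof. by rewrite /is_form dhomogX /= mdeg1. Qed.

Lemma is_form_sqnormp : is_form 2 sqnormp.
Proof. by apply: rpred_sum => i _; apply: (dhomogMn 2 (is_form_varp i)). Qed.

Lemma evalp_varp i x : evalp (varp i) x = x 0 i.
Proof. by rewrite /evalp mevalXU. Qed.

Lemma enorm_sqr x : enorm x ^+ 2 = dotp x x.
Proof. by rewrite sqr_sqrtr // sumr_ge0 // => i _; rewrite -expr2 sqr_ge0. Qed.

Lemma evalp_sqnormp x : evalp sqnormp x = enorm x ^+ 2.
Proof.
rewrite enorm_sqr /evalp raddf_sum /=; apply: eq_bigr => i _.
by rewrite rmorphXn /= -/(evalp _ x) evalp_varp expr2.
Qed.

Lemma evalp_euler d F x :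
  is_form d F -> \sum_(i < n) x 0 i * evalp (mderiv i F) x = d%:R * evalp F x.
Proof.
move=> /euler_form E; rewrite mulr_natl /evalp -mevalMn -E raddf_sum /=.
by apply: eq_bigr => i _; rewrite mevalM -/(evalp (varp i) x) evalp_varp.
Qed.

(** Writing [g] as twice [k.+1] makes [enorm x ^+ (g - 2)] the value of [sqnormp ^+ k]; the sign [e]
    serves both cases at once. *)
Lemma sos_norm_plus_form k (g := (k.+1).*2) F (e : R) :
    e ^+ 2 = 1 -> is_form g F ->
    (forall x, enorm (grad F x) ^+ 2 =
       g%:R ^+ 2 * enorm x ^+ (2 * g - 2)) ->
  sos_of_forms (g - 1)
    (fun x => enorm x ^+ (g - 2) * (enorm x ^+ g + e * evalp F x)).
Proof.
move=> e2 hF hgrad.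
have gE : g = (2 * k + 2)%N by rewrite /g doubleS -mul2n addn2.
have g0 : (g%:R : R) != 0 by rewrite pnatr_eq0.
(* A sum of squares carries no coefficients, so the factor [1 / (2 g^2)] is absorbed into the forms
   through its square root. *)
pose c : R := Num.sqrt (2%:R * g%:R ^+ 2)^-1.
have c2 : c ^+ 2 = (2%:R * g%:R ^+ 2)^-1.
  by rewrite sqr_sqrtr // invr_ge0 mulr_ge0 // sqr_ge0.
pose q i := c *: (g%:R *: (sqnormp ^+ k * varp i) + e *: mderiv i F).
exists [seq q i | i <- index_enum 'I_n]; split=> [p /mapP[i _ ->]|x].
  rewrite /is_form; apply/rpredZ/rpredD; apply: rpredZ.
    have -> : (g - 1 = 2 * k + 1)%N by rewrite gE -addnBA.
    exact: dhomogM (dhomogMn k is_form_sqnormp) (is_form_varp i).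
  exact: is_form_mderiv.
have qE i : evalp (q i) x = c * (g%:R * (enorm x ^+ (2 * k) * x 0 i)
    + e * evalp (mderiv i F) x).
  rewrite /evalp /q mevalZ mevalD !mevalZ mevalM rmorphXn /=.
  by rewrite -/(evalp sqnormp x) -/(evalp (varp i) x) evalp_sqnormp evalp_varp
    exprM.
rewrite big_map.
have := hgrad x; rewrite enorm_sqr {1}/dotp => hg.
have hx := enorm_sqr x; have hE := evalp_euler x hF.
set r := enorm x in hg hx qE *.
(* Expanding the squares leaves three sums: [|x|^2], Euler's sum and [|grad F|^2]. *)
have -> : \sum_(i < n) evalp (q i) x ^+ 2 =
    c ^+ 2 * ((g%:R * r ^+ (2 * k)) ^+ 2 * (\sum_(i < n) x 0 i * x 0 i)
    + 2%:R * g%:R * r ^+ (2 * k) * e * (\sum_(i < n) x 0 i * evalp (mderiv i F) x)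
    + e ^+ 2 * (\sum_(i < n) grad F x 0 i * grad F x 0 i)).
  rewrite !mulr_sumr -!big_split mulr_sumr; apply: eq_bigr => i _ /=.
  by rewrite qE !mxE; ring.
(* The outer terms both become [g^2 |x|^(2g-2)], and the cross term becomes
   [2 g^2 |x|^(g-2) e F]. *)
rewrite hg -/(dotp x x) -hx hE e2 c2.
have -> : (g - 2 = 2 * k)%N by rewrite gE addnK.
have -> : (2 * g - 2 = 2 * k + (2 * k + 2))%N.
  by rewrite gE mulnDr -addnBA // [(2 * (2 * k))%N]mul2n -addnn addnA.
have -> : r ^+ g = r ^+ (2 * k) * r ^+ 2 by rewrite -exprD gE.
by rewrite !exprD; field.
Qed.

End Forms.

Theorem proposition2p2 (R : realType) (n g : nat) (F : mpoly n R)
    (hg : g \in [:: 2; 4; 6]%N) (hF : isoparametric_polynomial g F) :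
  sos_of_forms (g - 1) (fun x => enorm x ^+ (g - 2) * G_plus g F x) /\
  sos_of_forms (g - 1) (fun x => enorm x ^+ (g - 2) * G_minus g F x).
Proof.
have [k gE] : exists k, g = (k.+1).*2.
  by move: hg; rewrite !inE => /or3P[] /eqP ->; [exists 0|exists 1|exists 2].
move: hF => [mp [mm [_ hform hgrad _ _]]]; subst g.
(* [e = 1] gives [G_plus], and [e = -1] gives [G_minus]. *)
have [s [hs Es]] := sos_norm_plus_form _ (expr1n R 2) hform hgrad.
have [t [ht Et]] := sos_norm_plus_form _ (etrans (sqrrN 1) (expr1n R 2)) hform hgrad.
split.
  by exists s; split=> // x; rewrite -Es mul1r.
by exists t; split=> // x; rewrite -Et mulN1r.
Qed.
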